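(* Let $n\ge3$, let $id=12\cdots n\in\mathcal S_n$ and $v=1\,2\cdots(n-3)\,(n-1)\,(n-2)\,n\in\mathcal S_n$. For $u\in\mathcal S_n$ let $[u]_{sh}$ be its shift equivalence class and $[u]_{ss}$ its super-strong Wilf equivalence class in $\mathcal S_n$. Then $[u]_{sh}=[u]_{ss}$ if $u\sim_{ss}id$ or $u\sim_{ss}v$, and otherwise $[u]_{sh}=[u]_{ss}\sqcup[\tilde u]_{ss}$ (a disjoint union).
   Context: $\tilde u$ denotes the reversal $u_n\cdots u_1$ of $u=u_1\cdots u_n$. Rigid shift: for a word $u=u_1\cdots u_n$ over $\mathbb P$, an integer $h\ge0$ and an integer $t$ such that for every $i$ with $u_i>h$ we have $1\le i+t\le n$ and $u_{i+t}\ge h$, the word $v$ with $v_j=\min(u_j,h)+\max(u_{j-t}-h,0)$ (second term $0$ if $j-t\notin[n]$) is a rigid shift of $u$ (cutting the skyline diagram at height $h$ and rigidly translating the part above the cut by $t$ so that each moved column rests on a column of height $h$). Two words are shift equivalent if one can be obtained from the other by a finite sequence of rigid shifts and reversals. Super-strong Wilf equivalence: for finite words $u,w$ over $\mathbb P$, $j$ is an embedding index of $u$ in $w$ if $j+|u|-1\le|w|$ and $u_k\le w_{j+k-1}$ for all $k$; $Em(u,w)$ is the set of such $j$; $u\sim_{ss}v$ if there is a bijection $f$ of the set of finite words over $\mathbb P$ preserving length and sum of letters with $Em(u,w)=Em(v,f(w))$ for all $w$. *)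

(* Defs.v *)
From HB Require Import structures.
From mathcomp Require Import all_boot all_order all_algebra.
From Stdlib Require Import Relation_Operators.
Set Implicit Arguments. Unset Strict Implicit. Unset Printing Implicit Defensive.
Import GRing.Theory Num.Theory.

Definition posword (s : seq nat) : bool := all (fun x => 0 < x) s.
Definition word := {s : seq nat | posword s}.

(* 0-indexed letter at an integer position; 0 outside [0, size u). *)
Definition letter (u : seq nat) (k : int) : nat :=
  match k with Posz m => nth 0 u m | Negz _ => 0 end.

Definition shift_ok (u : seq nat) (h : nat) (t : int) : Prop :=
  forall i : nat, i < size u -> h < nth 0 u i ->
    (0 <= i%:Z + t)%R /\ (i%:Z + t < (size u)%:Z)%R /\ h <= letter u (i%:Z + t).

Definition shift_word (u : seq nat) (h : nat) (t : int) : seq nat :=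
  mkseq (fun j => minn (nth 0 u j) h + (letter u (j%:Z - t)%R - h)) (size u).

Definition rigid_shift (u v : seq nat) : Prop :=
  exists (h : nat) (t : int), shift_ok u h t /\ v = shift_word u h t.

Definition shift_step (u v : seq nat) : Prop := rigid_shift u v \/ v = rev u.

Definition shift_equiv (u v : seq nat) : Prop :=
  clos_refl_trans _ shift_step u v \/ clos_refl_trans _ shift_step v u.

Definition emb_index (u w : seq nat) (j : nat) : bool :=
  (j + size u <= size w) && all2 leq u (take (size u) (drop j w)).

Definition ss_equiv (u v : seq nat) : Prop :=
  exists f : word -> word,
    bijective f /\
    (forall w, size (val (f w)) = size (val w) /\ sumn (val (f w)) = sumn (val w)) /\
    (forall w j, emb_index u (val w) j = emb_index v (val (f w)) j).

Definition is_perm (n : nat) (u : seq nat) : bool := perm_eq u (iota 1 n).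

Definition id_perm (n : nat) : seq nat := iota 1 n.
Definition v_perm (n : nat) : seq nat := iota 1 (n - 3) ++ [:: n - 1; n - 2; n].

(* Main.v *)
Require Import Defs.
From mathcomp Require Import all_boot all_order all_algebra.
From mathcomp Require Import zify.
From Stdlib Require Import Relation_Operators.
Set Implicit Arguments. Unset Strict Implicit. Unset Printing Implicit Defensive.
Import GRing.Theory Num.Theory.

(** Write P_i(u) for the set of positions of letters > i in u. Two words are linked by rigid shifts iff P_i(u) and P_i(w) are translates of each other for every i, and for permutations this is also super-strong Wilf equivalence. Indeed, the words in which u occurs at all indices of F are those above the least such word, whose sum is the sum over i of the cardinalities of the sumsets P_i(u) + F, up to a constant; by inclusion-exclusion, super-strong equivalence says that these sums agree for all F. Inclusion-exclusion then turns unions into intersections, so the number of pairs (i, x) with x + F contained in P_i(u) is an invariant for every F; taking F = P_i(u) and inducting on i recovers each P_i up to translation. Reversal reflects every P_i, so the two classes of u and its reversal merge exactly when every P_i is symmetric. As P_(i+1) is P_i minus one point, all P_i are intervals, which is the case of the identity, or a midpoint is removed from an interval; the next set is then symmetric only when that interval has length 3, which is the case of v. *)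

(** * Rigid shifts and translates of levels *)

(** Levels are compared as characteristic functions on all integers, [letter] being zero outside the
    word, so the ends need no special care. The offset [t] depends on the level. *)
Definition translate (u w : seq nat) : Prop :=
  size u = size w /\
  forall i : nat, exists t : int, forall z : int,
    (i < letter w (z + t)%R) = (i < letter u z).

Lemma letter_gt_range u i z :
  i < letter u z -> (0 <= z)%R /\ (z < (size u)%:Z)%R.
Proof.
case: z => [m|m] //= h; split=> //.
by case: (ltnP m (size u)) h => // hm; rewrite nth_default.
Qed.

Lemma letter_le_sumn u z : letter u z <= sumn u.
Proof.
case: z => // m /=; elim: u m => [|x u IH] [|m] //=; first by rewrite leq_addr.
exact: leq_trans (IH m) (leq_addl _ _).
Qed.

Lemma translate_refl u : translate u u.
Proof. by split=> // i; exists 0%R => z; rewrite addr0. Qed.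

Lemma translate_sym u w : translate u w -> translate w u.
Proof.
move=> [hs ht]; split=> // i; have [t h] := ht i.
by exists (- t)%R => z; rewrite -h subrK.
Qed.

Lemma translate_trans u v w : translate u v -> translate v w -> translate u w.
Proof.
move=> [hs ht] [hs' ht']; split=> [|i]; first exact: etrans hs hs'.
have [t h] := ht i; have [t' h'] := ht' i.
by exists (t + t')%R => z; rewrite addrA h' h.
Qed.

Lemma letter_rev u z : letter (rev u) z = letter u ((size u)%:Z - 1 - z)%R.
Proof.
case: (boolP ((0 <= z)%R && (z < (size u)%:Z)%R)) => [/andP[h1 h2]|hz].
  case: z h1 h2 => // m _ hm; have hm' : m < size u by lia.
  have -> : ((size u)%:Z - 1 - m%:Z)%R = Posz (size u - m.+1) by lia.
  by rewrite /= nth_rev.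
have out v y : ~~ ((0 <= y)%R && (y < (size v)%:Z)%R) -> letter v y = 0.
  move=> hy; apply/eqP; rewrite -leqn0 leqNgt; apply: contra hy.
  by move=> /letter_gt_range[-> ->].
rewrite !out ?size_rev //; lia.
Qed.

Lemma translate_rev u w : translate u w -> translate (rev u) (rev w).
Proof.
move=> [hs ht]; split=> [|i]; first by rewrite !size_rev.
have [t h] := ht i; exists (- t)%R => z.
by rewrite !letter_rev -h hs; congr (_ < letter _ _); lia.
Qed.

(** A moved column rests on a letter at least [h], so it adds nothing to levels below [h]; from [h]
    on, a level consists of moved parts alone. *)
Lemma letter_shift_word u h t i z : shift_ok u h t ->
  (i < letter (shift_word u h t) z)
  = (i < letter u (if i < h then z else (z - t)%R)).
Proof.
move=> ok.
have ok' y : h < letter u y -> (0 <= y + t)%R /\ (y + t < (size u)%:Z)%R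
    /\ h <= letter u (y + t)%R.
  move=> hy; have [y0 yn] := letter_gt_range hy.
  by case: y hy y0 yn => // m hm _ hs; apply: ok; first by lia.
have ok2 := ok' (z - t)%R; rewrite subrK in ok2.
case: (boolP ((0 <= z)%R && (z < (size u)%:Z)%R)) => [/andP[h1 h2]|hz].
  case: z h1 h2 ok2 => // m _ hm ok2; have hm' : m < size u by lia.
  rewrite [letter (shift_word _ _ _) _]/= nth_mkseq //.
  have -> : nth 0 u m = letter u m by [].
  by case: (ltnP i h) => hi; case: (ltnP h (letter u (m%:Z - t)%R)) => hl;
    [have [_ [_ ?]] := ok2 hl; lia | lia | have [_ [_ ?]] := ok2 hl; lia | lia].
have -> : i < letter (shift_word u h t) z = false.
  apply: contraNF hz => /letter_gt_range; rewrite size_mkseq; lia.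
symmetry; case: ifP => hi; apply: contraNF hz.
  by move=> /letter_gt_range[-> ->].
move=> hl; have hh : h < letter u (z - t)%R by lia.
by have [-> [-> _]] := ok2 hh.
Qed.

Lemma rigid_shift_translate u v : rigid_shift u v -> translate u v.
Proof.
move=> [h [t [ok ->]]]; split=> [|i]; first by rewrite size_mkseq.
case: (ltnP i h) => hi.
  by exists 0%R => z; rewrite (letter_shift_word _ _ ok) hi addr0.
by exists t => z; rewrite (letter_shift_word _ _ ok) (ltnNge i h) hi /= addrK.
Qed.

(** Reversal carries translates to translates, so only the parity of the number of reversals
    matters. *)
Lemma clos_shift_step_translate u w :
  clos_refl_trans _ shift_step u w -> translate u w \/ translate (rev u) w.
Proof.
elim=> [x y [/rigid_shift_translate|->]|x|x y z _ h1 _ h2]; first by left.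
- by right; apply: translate_refl.
- by left; apply: translate_refl.
case: h1 => h1; case: h2 => h2.
- by left; apply: translate_trans h2.
- by right; apply: translate_trans (translate_rev h1) h2.
- by right; apply: translate_trans h2.
- left; apply: translate_trans h2.
  by rewrite -[x in translate x _]revK; apply: translate_rev.
Qed.

Lemma shift_equiv_translate u w :
  shift_equiv u w -> translate u w \/ translate (rev u) w.
Proof.
case=> /clos_shift_step_translate [h|h]; [by left|by right| |].
  by left; apply: translate_sym.
by right; rewrite -(revK w); apply: translate_rev; apply: translate_sym.
Qed.

Lemma eq_from_levels u w : size u = size w ->
  (forall i z, (i < letter w z) = (i < letter u z)) -> u = w.
Proof.
move=> hs h; apply: (@eq_from_nth _ 0) => // k _.
have := h (nth 0 u k) (Posz k); have := h (nth 0 w k) (Posz k); rewrite /=; lia.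
Qed.

(* Aligns the levels one at a time: cutting at height [h] moves all levels above [h] by the translation that aligns level [h]. *)
Lemma translate_clos_shift_step_from d h u w : translate u w ->
  (forall z, letter u z <= h + d) -> (forall z, letter w z <= h + d) ->
  (forall i z, i < h -> (i < letter w z) = (i < letter u z)) ->
  clos_refl_trans _ shift_step u w.
Proof.
elim: d h u => [|d IH] h u [hs ht] bu bw hlow.
  rewrite (@eq_from_levels u w) //; first exact: rt_refl.
  move=> i z; case: (ltnP i h) => hi; first exact: hlow.
  have := bu z; have := bw z; lia.
have [t th] := ht h.
have ok : shift_ok u h t.
  move=> i hi hu; have hw : h < letter w (Posz i + t)%R by rewrite th.
  have [h0 hn] := letter_gt_range hw; rewrite hs; split=> //; split=> //.
  (* For positive [h], level [h - 1] is already aligned, so a column landing in level [h] of [w]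
     lands on a letter of [u] at least [h]. *)
  case: h hlow hu hw {th bu bw} => // h hlow hu hw; rewrite -hlow //; lia.
have lv := letter_shift_word _ _ ok.
set u' := shift_word u h t in lv.
have step : rigid_shift u u' by exists h, t.
apply: (rt_trans _ _ _ u'); first by apply: rt_step; left.
apply: (IH h.+1).
- exact: translate_trans (translate_sym (rigid_shift_translate step)) (conj hs ht).
- move=> z; rewrite addSnnS leqNgt lv.
  by case: ifP => _; rewrite -leqNgt; apply: bu.
- by move=> z; rewrite addSnnS.
- move=> i z; rewrite ltnS leq_eqVlt lv => /orP[/eqP->|hi].
    by rewrite ltnn -th subrK.
  by rewrite hi hlow.
Qed.

Lemma translate_clos_shift_step u w :
  translate u w -> clos_refl_trans _ shift_step u w.
Proof.
move=> h; apply: (@translate_clos_shift_step_from (sumn u + sumn w) 0) => // z.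
  by rewrite (leq_trans (letter_le_sumn u z)) ?leq_addr.
by rewrite (leq_trans (letter_le_sumn w z)) ?leq_addl.
Qed.

Lemma shift_equivP u w :
  shift_equiv u w <-> translate u w \/ translate (rev u) w.
Proof.
split=> [|[|] /translate_clos_shift_step h]; first exact: shift_equiv_translate.
  by left.
by left; apply: rt_trans h; apply: rt_step; right.
Qed.

(** * Translates of levels and super-strong equivalence *)

(* The least positive word of length [N] having an occurrence of [u] at each index in [F]. *)
Definition cover_word (u : seq nat) (F : seq nat) (N : nat) : seq nat :=
  mkseq (fun p => foldr maxn 1 [seq letter u (Posz p - Posz e)%R | e <- F]) N.

Definition dominates (w m : seq nat) : bool :=
  (size w == size m) && all (fun p => nth 0 m p <= nth 0 w p) (iota 0 (size w)).

Lemma dominatesP w m : reflect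
  (size w = size m /\ forall p, p < size w -> nth 0 m p <= nth 0 w p)
  (dominates w m).
Proof.
apply: (iffP andP) => -[h1 h2]; split; try by apply/eqP.
  by move=> p hp; move/allP: h2; apply; rewrite mem_iota.
by apply/allP => p; rewrite mem_iota => /andP[_]; apply: h2.
Qed.

Lemma foldr_maxn_gt i s : (i < foldr maxn 1 s) = (i == 0) || has (fun x => i < x) s.
Proof.
elim: s => [|x s IH] /=; first by lia.
by rewrite leq_max IH; case: (i == 0) => /=; rewrite ?orbT.
Qed.

(** For [i > 0], level [i] of the cover word is the sumset P_i(u) + F within the first [N]
    positions; the floor 1 fills level 0. *)
Lemma cover_gt u F N p i : p < N -> (i < nth 0 (cover_word u F N) p) =
  (i == 0) || has (fun e => i < letter u (Posz p - Posz e)%R) F.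
Proof. by move=> hp; rewrite nth_mkseq // foldr_maxn_gt has_map. Qed.

Lemma posword_cover u F N : posword (cover_word u F N).
Proof.
apply/(all_nthP 0) => p; rewrite size_mkseq => hp.
by rewrite cover_gt.
Qed.

Lemma all2_leq_nth s t : size s = size t ->
  all2 leq s t <-> forall k, k < size s -> nth 0 s k <= nth 0 t k.
Proof.
elim: s t => [|x s IH] [|y t] //= [hs]; split.
  by move=> /andP[hx /(IH _ hs) h] [|k] //; apply: h.
move=> h; apply/andP; split; first exact: (h 0).
by apply/(IH _ hs) => k; apply: (h k.+1).
Qed.

(** Level by level, an occurrence at [j] means that P_i(u) + j lies in P_i(w); occurrences at
    several indices then combine into unions. *)
Lemma emb_indexP u w j : emb_index u w j <->
  j + size u <= size w /\
  forall p i, p < size w -> i < letter u (Posz p - Posz j)%R -> i < nth 0 w p.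
Proof.
rewrite /emb_index; split.
  move=> /andP[hj]; have hs : size u = size (take (size u) (drop j w)).
    by rewrite size_takel // size_drop; lia.
  move/(all2_leq_nth hs) => h; split=> // p i hp hl.
  have [h0 hn] := letter_gt_range hl.
  have hk : p - j < size u by lia.
  have := h _ hk; rewrite nth_take // nth_drop subnKC; last by lia.
  move=> hle; apply: leq_trans hle.
  by have E : (Posz p - Posz j)%R = Posz (p - j) by [lia]; move: hl; rewrite E.
move=> [hj h]; rewrite hj /=.
have hs : size u = size (take (size u) (drop j w)).
  by rewrite size_takel // size_drop; lia.
apply/(all2_leq_nth hs) => k hk; rewrite nth_take // nth_drop leqNgt.
apply/negP => hlt.
have := h (j + k) (nth 0 w (j + k)); rewrite ltnn => /(_ _ _)/negP; apply => //.
  by lia.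
have -> : (Posz (j + k) - Posz j)%R = Posz k by lia.
by [].
Qed.

Definition in_range (n : nat) (F : seq nat) (N : nat) : bool :=
  all (fun e => e + n <= N) F.

(** Positivity of [w] matches the floor 1 of [cover_word]. *)
Lemma all_emb_index u w F : posword w ->
  all (emb_index u w) F = in_range (size u) F (size w) && dominates w (cover_word u F (size w)).
Proof.
move=> pw; apply/idP/andP.
  move=> /allP h; split; first by apply/allP => e /h /emb_indexP[].
  apply/dominatesP; rewrite size_mkseq; split=> // p hp.
  rewrite leqNgt; apply/negP; rewrite cover_gt // => /orP[/eqP h0|/hasP[e /h]].
    by move/(all_nthP 0): pw => /(_ p hp); rewrite h0.
  by move=> /emb_indexP[_ he] /(he _ _ hp); rewrite ltnn.
move=> [/allP hr /dominatesP[_ hd]]; apply/allP => e he; apply/emb_indexP.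
split=> [|p i hp hi]; first exact: hr.
apply: leq_trans (hd p hp); rewrite cover_gt //; apply/orP; right.
by apply/hasP; exists e.
Qed.

(** Layer-cake summation: a letter is the number of thresholds below it. *)
Lemma sumn_count_gt K s : all (fun x => x <= K) s ->
  sumn s = \sum_(i < K) count (fun x => i < x) s.
Proof.
elim: s => [|x s IH] /=; first by rewrite big1.
move=> /andP[hx /IH->]; rewrite big_split /=; congr addn.
elim: K hx {IH} => [|K IH]; first by rewrite leqn0 big_ord0 => /eqP.
rewrite leq_eqVlt big_ord_recr /= => /orP[/eqP->|]; last by move=> h; rewrite -IH; lia.
rewrite ltnSn (eq_bigr (fun _ => 1)) => [|i _]; first by rewrite sum_nat_const card_ord; lia.
by have := ltn_ord i; lia.
Qed.

Definition level_count (u F : seq nat) (N i : nat) : nat :=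
  count (fun p => has (fun e => i < letter u (Posz p - Posz e)%R) F) (iota 0 N).

Lemma sumn_cover K u F N : (forall z, letter u z <= K.+1) ->
  sumn (cover_word u F N) = N + \sum_(i < K) level_count u F N i.+1.
Proof.
move=> hK; rewrite (@sumn_count_gt K.+1); last first.
  apply/(all_nthP 0) => p; rewrite size_mkseq => hp.
  rewrite leqNgt cover_gt //; apply/negP => /hasP[e _]; rewrite ltnNge.
  by rewrite hK.
rewrite big_ord_recl; congr addn.
  rewrite count_map (@eq_count _ _ predT) ?count_predT ?size_iota // => p /=.
  by rewrite foldr_maxn_gt.
apply: eq_bigr => i _; rewrite count_map; apply: eq_count => p /=.
by rewrite foldr_maxn_gt has_map.
Qed.

(** The map p to p + t is injective, and the bound on [g'] keeps its images inside the window. *)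
Lemma count_translate_le (g g' : int -> bool) (t : int) N :
  (forall z, g' (z + t)%R = g z) ->
  (forall z, g' z -> (0 <= z)%R /\ (z < Posz N)%R) ->
  count (fun p => g (Posz p)) (iota 0 N) <= count (fun p => g' (Posz p)) (iota 0 N).
Proof.
move=> hg hr; rewrite -!size_filter -(size_map (fun p => absz (Posz p + t)%R)).
apply: uniq_leq_size.
  rewrite map_inj_in_uniq ?filter_uniq ?iota_uniq // => p q.
  rewrite !mem_filter -!hg => /andP[/hr hp _] /andP[/hr hq _] h; lia.
move=> q /mapP[p]; rewrite !mem_filter -hg => /andP[gp _] ->.
have [h0 hn] := hr _ gp; have E : Posz (absz (Posz p + t)%R) = (Posz p + t)%R by lia.
by rewrite E gp mem_iota; lia.
Qed.

Lemma level_count_translate_le u v F N i t : size u = size v ->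
  in_range (size u) F N ->
  (forall z, (i < letter v (z + t)%R) = (i < letter u z)) ->
  level_count u F N i <= level_count v F N i.
Proof.
move=> hs /allP hr ht.
pose g w (z : int) := has (fun e => i < letter w (z - Posz e)%R) F.
apply: (@count_translate_le (g u) (g v) t) => z.
  by rewrite /g; apply: eq_has => e /=; rewrite -ht; congr (_ < letter _ _); lia.
move=> /hasP[e /hr he] /letter_gt_range; lia.
Qed.

Lemma translate_sumn_cover u v F N : translate u v -> in_range (size u) F N ->
  sumn (cover_word u F N) = sumn (cover_word v F N).
Proof.
move=> [hs ht] hr; pose K := sumn u + sumn v.
rewrite !(@sumn_cover K); first last.
- by move=> z; have := letter_le_sumn u z; rewrite /K; lia.
- by move=> z; have := letter_le_sumn v z; rewrite /K; lia.
congr addn; apply: eq_bigr => i _; have [t h] := ht i.+1.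
apply/eqP; rewrite eqn_leq (level_count_translate_le hs hr h).
apply: (@level_count_translate_le _ _ _ _ _ (- t)%R); rewrite -?hs // => z.
by rewrite -h subrK.
Qed.

(** No letter exceeds the sum [s], so tuples over ['I_s.+1] give every word of this length and
    sum. *)
Definition words (N s : nat) : seq (seq nat) :=
  [seq w <- undup [seq map val (val t) | t : N.-tuple 'I_s.+1]
         | posword w && (sumn w == s)].

Lemma mem_words N s w :
  (w \in words N s) = [&& size w == N, posword w & sumn w == s].
Proof.
rewrite mem_filter mem_undup andbC.
case: (boolP (posword w && (sumn w == s))) => h; rewrite /= ?andbF //; last first.
rewrite ?andbT; apply/mapP/eqP => [[t _ ->]|hN]; first by rewrite size_map size_tuple.
have hb k : nth 0 w k <= s.
  by case/andP: h => _ /eqP <-; apply: (letter_le_sumn w (Posz k)).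
have ht : size [seq inord x : 'I_s.+1 | x <- w] == N by rewrite size_map hN.
exists (Tuple ht); first by rewrite mem_enum.
rewrite /= -map_comp -[LHS]map_id; apply/eq_in_map => x /(nthP 0)[k _ <-].
by rewrite /= inordK // ltnS.
Qed.

Lemma sumn_mkseq f N : sumn (mkseq f N) = \sum_(p < N) f p.
Proof. by rewrite sumnE big_map -(big_mkord xpredT f) /index_iota subn0. Qed.

(* Adding [m' - m] letterwise injects the words above [m] into those above [m']. *)
Lemma count_dominates_le m m' s : size m = size m' -> sumn m = sumn m' ->
  posword m' ->
  count (dominates^~ m) (words (size m) s) <= count (dominates^~ m') (words (size m) s).
Proof.
move=> hs hm pm'; set N := size m.
pose phi (w : seq nat) := mkseq (fun p => nth 0 w p - nth 0 m p + nth 0 m' p) N.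
have mem_dom k w : (w \in [seq x <- words N s | dominates x k]) =
    [&& dominates w k, size w == N, posword w & sumn w == s].
  by rewrite mem_filter mem_words.
rewrite -!size_filter -(size_map phi); apply: uniq_leq_size.
  rewrite map_inj_in_uniq ?filter_uniq ?undup_uniq // => w1 w2.
  rewrite !mem_dom => /and3P[/dominatesP[s1 d1] _ _] /and3P[/dominatesP[s2 d2] _ _] h.
  apply: (@eq_from_nth _ 0); first by rewrite s1 s2.
  move=> p hp; have hpN : p < N by rewrite /N -s1.
  have := congr1 (nth 0 ^~ p) h; rewrite /= !nth_mkseq //.
  have := d1 p hp; have := d2 p; rewrite s2 -s1 => /(_ hp); lia.
move=> x /mapP[w]; rewrite mem_dom => /and3P[/dominatesP[sw dw] _ /andP[pw /eqP sumw]] ->.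
rewrite mem_dom size_mkseq eqxx /=; apply/and3P; split.
- apply/dominatesP; rewrite size_mkseq; split=> // p hp.
  by rewrite nth_mkseq //; lia.
- apply/(all_nthP 0) => p; rewrite size_mkseq => hp; rewrite nth_mkseq //.
  have := all_nthP 0 pm' p; rewrite -hs => /(_ hp); lia.
have e : sumn (phi w) + sumn m = sumn w + sumn m'.
  have E (a : seq nat) : size a = N -> sumn a = \sum_(p < N) nth 0 a p.
    by move=> <-; rewrite -sumn_mkseq mkseq_nth.
  rewrite (E w) // (E m) // (E m') // sumn_mkseq -!big_split /=.
  apply: eq_bigr => p _; have := dw p; rewrite sw => /(_ (ltn_ord p)); lia.
by apply/eqP; lia.
Qed.

(** * From cover sums to counts of words by embedding indices *)

Section FromCovers.
Variables u v : seq nat.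
Hypothesis size_uv : size u = size v.
Hypothesis cover_uv : forall F N, in_range (size u) F N ->
  sumn (cover_word u F N) = sumn (cover_word v F N).

(** The number of words above a positive bound depends only on the length and sum of that bound;
    when [F] is out of range both counts vanish. *)
Lemma count_all_emb F N s :
  count (fun w => all (emb_index u w) F) (words N s)
  = count (fun w => all (emb_index v w) F) (words N s).
Proof.
have rw x : size x = size u ->
  count (fun w => all (emb_index x w) F) (words N s)
  = in_range (size u) F N * count (dominates^~ (cover_word x F N)) (words N s).
  move=> hx; case: (boolP (in_range (size u) F N)) => hr.
    rewrite mul1n; apply: eq_in_count => w; rewrite mem_words => /and3P[/eqP hN pw _].
    by rewrite all_emb_index // hN hx hr.
  rewrite mul0n; apply/eqP; rewrite -leqn0 leqNgt -has_count; apply/hasPn => w.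
  rewrite mem_words => /and3P[/eqP hN pw _].
  by rewrite all_emb_index // hN hx negb_and hr.
rewrite !rw //; case: (boolP (in_range (size u) F N)) => hr //; congr muln.
have := cover_uv hr; have := posword_cover u F N; have := posword_cover v F N.
have : size (cover_word v F N) = N by rewrite size_mkseq.
have : size (cover_word u F N) = N by rewrite size_mkseq.
move: (cover_word u F N) (cover_word v F N) => m m' sm sm' pm' pm e.
apply/eqP; rewrite eqn_leq -{1 2}sm -{1 2}sm'.
by rewrite !count_dominates_le // sm sm'.
Qed.

(* Inclusion-exclusion, one candidate index at a time. *)
Lemma count_emb_pattern I F b N s :
  count (fun w => all (emb_index u w) F && (map (emb_index u w) I == b)) (words N s)
  = count (fun w => all (emb_index v w) F && (map (emb_index v w) I == b)) (words N s).
Proof.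
elim: I F b => [|j I IH] F [|c b] /=.
- by under eq_count do rewrite andbT; under [RHS]eq_count do rewrite andbT; apply: count_all_emb.
- by under eq_count do rewrite andbF; under [RHS]eq_count do rewrite andbF.
- by under eq_count do rewrite andbF; under [RHS]eq_count do rewrite andbF.
pose A x w := all (emb_index x w) (j :: F) && (map (emb_index x w) I == b).
have tr : count (A u) (words N s) = count (A v) (words N s) by apply: IH.
case: c.
  rewrite (@eq_count _ _ (A u)) ?(@eq_count _ (fun w => _ && (_ == true :: _)) (A v)) //.
    by move=> w; rewrite /A /= eqseq_cons eqb_id; case: (emb_index v w j); rewrite /= ?andbF.
  by move=> w; rewrite /A /= eqseq_cons eqb_id; case: (emb_index u w j); rewrite /= ?andbF.
pose B x w := all (emb_index x w) F && ((emb_index x w j :: map (emb_index x w) I) == false :: b).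
pose C x w := all (emb_index x w) F && (map (emb_index x w) I == b).
have split x : count (B x) (words N s) + count (A x) (words N s) = count (C x) (words N s).
  elim: (words N s) => //= w l <-; rewrite /A /B /C /= eqseq_cons.
  by case: (emb_index x w j); case: (all _ _); case: (_ == b) => /=; lia.
have := split u; have := split v; have := IH F b; rewrite -/(B u) -/(B v).
by rewrite -!/(C _) tr; lia.
Qed.

(** Indices up to [size w] suffice, as no larger one can be an embedding index. *)
Definition emb_pattern (x w : seq nat) : seq bool :=
  map (emb_index x w) (iota 0 (size w).+1).

Definition fiber (x : seq nat) N s b := [seq w <- words N s | emb_pattern x w == b].

Lemma size_fiber N s b : size (fiber u N s b) = size (fiber v N s b).
Proof.
have rw x : size (fiber x N s b) = count (fun w => all (emb_index x w) [::] &&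
    (map (emb_index x w) (iota 0 N.+1) == b)) (words N s).
  rewrite size_filter; apply: eq_in_count => w; rewrite mem_words => /and3P[/eqP hN _ _].
  by rewrite /emb_pattern hN.
by rewrite !rw count_emb_pattern.
Qed.

End FromCovers.

(** Sends [w] to the word of the same rank in the matching fiber for [y]. *)
Definition transfer (x y w : seq nat) : seq nat :=
  let k z := fiber z (size w) (sumn w) (emb_pattern x w) in
  nth [::] (k y) (index w (k x)).

Lemma mem_fiber x N s b w : (w \in fiber x N s b) =
  [&& emb_pattern x w == b, size w == N, posword w & sumn w == s].
Proof. by rewrite mem_filter mem_words. Qed.

(** Length, sum and pattern are kept, so the way back uses the same two fibers, which have no
    repetitions. *)
Lemma transferP x y w : posword w ->
  (forall N s b, size (fiber x N s b) = size (fiber y N s b)) ->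
  [/\ emb_pattern y (transfer x y w) = emb_pattern x w,
      size (transfer x y w) = size w, posword (transfer x y w),
      sumn (transfer x y w) = sumn w & transfer y x (transfer x y w) = w].
Proof.
move=> pw hs; set w' := transfer x y w.
set N := size w; set s := sumn w; set b := emb_pattern x w.
have hw : w \in fiber x N s b by rewrite mem_fiber !eqxx pw.
have hi : index w (fiber x N s b) < size (fiber y N s b) by rewrite -hs index_mem.
have hw' : w' \in fiber y N s b by apply: mem_nth.
move: (hw'); rewrite mem_fiber => /and4P[/eqP h1 /eqP h2 h3 /eqP h4].
split=> //; rewrite /transfer h1 h2 h4.
by rewrite /w' /transfer index_uniq ?nth_index // filter_uniq // filter_uniq // undup_uniq.
Qed.

Lemma emb_index_pattern x y w w' : size x = size y -> size w = size w' ->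
  emb_pattern x w = emb_pattern y w' ->
  forall j, emb_index x w j = emb_index y w' j.
Proof.
move=> hx hw h j; case: (ltnP j (size w).+1) => hj.
  have := congr1 (nth false ^~ j) h.
  by rewrite /emb_pattern -hw !(nth_map 0) ?size_iota // nth_iota.
by rewrite /emb_index !(leqNgt (_ + _)) -hx -hw (_ : size w < _) //; lia.
Qed.

Lemma translate_ss_equiv u v : translate u v -> ss_equiv u v.
Proof.
move=> t; have hs := t.1.
have huv N s b : size (fiber u N s b) = size (fiber v N s b).
  by apply: size_fiber => // F M; apply: translate_sumn_cover.
have hvu N s b : size (fiber v N s b) = size (fiber u N s b) by rewrite huv.
pose tr x y (h : forall N s b, size (fiber x N s b) = size (fiber y N s b)) (w : word) : word :=
  exist _ (transfer x y (val w)) (let: And5 _ _ p _ _ := transferP (valP w) h in p).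
exists (tr _ _ huv); split; [|split].
- exists (tr _ _ hvu) => w; apply: val_inj.
    by have [_ _ _ _ e] := transferP (valP w) huv.
  by have [_ _ _ _ e] := transferP (valP w) hvu.
- by move=> w; have [_ e1 _ e2 _] := transferP (valP w) huv.
- move=> w; have [e e1 _ _ _] := transferP (valP w) huv.
  by apply: emb_index_pattern.
Qed.

(** The image under [f] of the least word for [u] embeds [v] at all of [F], so it lies above the
    least word for [v], and its sum is unchanged. *)
Lemma ss_equiv_sumn_cover_le u v F N (f : word -> word) : size u = size v ->
  (forall w, size (val (f w)) = size (val w) /\ sumn (val (f w)) = sumn (val w)) ->
  (forall w j, emb_index u (val w) j = emb_index v (val (f w)) j) ->
  in_range (size u) F N -> sumn (cover_word v F N) <= sumn (cover_word u F N).
Proof.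
move=> hs hf he hr; pose w : word := exist (fun s => is_true (posword s)) _ (posword_cover u F N).
have sw : size (val w) = N by rewrite size_mkseq.
have [sf sumf] := hf w.
have : all (emb_index u (val w)) F.
  rewrite all_emb_index ?(valP w) // sw hr /=; apply/dominatesP; split=> //.
rewrite (eq_all (he w)) all_emb_index ?(valP (f w)) // => /andP[_].
rewrite sf sw -[sumn (cover_word u F N)]/(sumn (val w)) -sumf => /dominatesP[].
move: (val (f w)) (cover_word v F N) => a c sac h.
rewrite -[c](mkseq_nth 0) -[a](mkseq_nth 0) !sumn_mkseq sac; apply: leq_sum => p _.
by apply: h; rewrite sac.
Qed.

Lemma ss_equiv_sumn_cover u v F N : size u = size v -> ss_equiv u v ->
  in_range (size u) F N -> sumn (cover_word u F N) = sumn (cover_word v F N).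
Proof.
move=> hs [f [[g fg gf] [hf he]]] hr; apply/eqP; rewrite eqn_leq.
rewrite (ss_equiv_sumn_cover_le hs hf he hr) andbT.
apply: (@ss_equiv_sumn_cover_le _ _ _ _ g); rewrite -?hs // => w.
  by have := hf (g w); rewrite gf => -[-> ->].
by move=> j; rewrite he gf.
Qed.

(** * Recovering the levels of a permutation *)

Lemma is_perm_size n u : is_perm n u -> size u = n.
Proof. by move=> /perm_size; rewrite size_iota. Qed.

Lemma is_perm_count_gt n u i : is_perm n u -> count (fun x => i < x) u = n - i.
Proof.
move=> /permP ->; elim: n => [|n IH] //.
rewrite -{1}(addn1 n) iotaD count_cat IH /= add1n; lia.
Qed.

Lemma is_perm_mem n u x : is_perm n u -> (x \in u) = (0 < x <= n).
Proof. by move=> /perm_mem ->; rewrite mem_iota add1n. Qed.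

Lemma is_perm_letter_le n u z : is_perm n u -> letter u z <= n.
Proof.
move=> hu; case: z => // m /=; case: (ltnP m (size u)) => hm; last by rewrite nth_default.
by have := mem_nth 0 hm; rewrite (is_perm_mem _ hu) => /andP[].
Qed.

Lemma is_perm_letter_gt0 n u z : is_perm n u ->
  (0 < letter u z) = (0 <= z)%R && (z < Posz n)%R.
Proof.
move=> hu; apply/idP/andP; first by move=> /letter_gt_range; rewrite (is_perm_size hu).
case: z => m [] //= _ hm; have hm' : m < size u by rewrite (is_perm_size hu).
by have := mem_nth 0 hm'; rewrite (is_perm_mem _ hu) => /andP[].
Qed.

Definition level (u : seq nat) i := [seq k <- iota 0 (size u) | i < nth 0 u k].

Lemma mem_level u i k : (k \in level u i) = (i < letter u (Posz k)).
Proof.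
rewrite mem_filter mem_iota /= add0n andbC; case: ltnP => //= h.
by rewrite nth_default.
Qed.

Lemma size_level n u i : is_perm n u -> size (level u i) = n - i.
Proof.
move=> hu; rewrite -(is_perm_count_gt i hu) size_filter.
by rewrite -{3}[u](mkseq_nth 0) /mkseq count_map.
Qed.

(** Interpolates between sumset sizes ([F] empty) and sizes of intersections of translates ([E] a
    single member of [F]). *)
Definition mixed_count (u F E : seq nat) (N i : nat) : nat :=
  count (fun p => all (fun e => i < letter u (Posz p - Posz e)%R) F &&
                  has (fun e => i < letter u (Posz p - Posz e)%R) E) (iota 0 N).

(* Inclusion-exclusion: trades a union constraint for an intersection constraint. *)
Lemma mixed_count_move u a F E N i :
  mixed_count u (a :: F) E N i + mixed_count u F (a :: E) N i
  = mixed_count u F [:: a] N i + mixed_count u F E N i.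
Proof.
rewrite /mixed_count; elim: (iota 0 N) => //= p l.
set x := all _ _; set h := has _ E; set b := i < _.
by case: x; case: h; case: b => /=; lia.
Qed.

(** * Invariance of the summed intersection counts *)

Section SumsOfCounts.
Variables (n : nat) (u v : seq nat).
Hypotheses (pu : is_perm n u) (pv : is_perm n v) (n_gt0 : 0 < n).
Hypothesis cover_uv : forall F N, in_range n F N ->
  sumn (cover_word u F N) = sumn (cover_word v F N).

(** Induction on [F] with [E] free: the induction hypothesis covers three of the four terms of
    [mixed_count_move], and the case of empty [F] comes from the cover sums. *)
Lemma sum_mixed_count F E N : in_range n F N -> in_range n E N ->
  \sum_(i < n) mixed_count u F E N i = \sum_(i < n) mixed_count v F E N i.
Proof.
elim: F E => [|a F IH] E /= => [_ rE|/andP[ra rF] rE].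
  have eqn : n = n.-1.+1 by rewrite prednK.
  have lvl x : \sum_(i < n) mixed_count x [::] E N i = \sum_(i < n) level_count x E N i by [].
  have cov x : is_perm n x -> sumn (cover_word x E N) = N + \sum_(i < n.-1) level_count x E N i.+1.
    by move=> px; apply: sumn_cover => z; rewrite -eqn; apply: is_perm_letter_le.
  have peel (f : nat -> nat) : \sum_(i < n) f i = f 0 + \sum_(i < n.-1) f i.+1.
    by rewrite -[in LHS](prednK n_gt0) big_ord_recl.
  have := cover_uv rE; rewrite !cov // => /addnI.
  (* Cover sums do not see level 0, but that level is the whole word for both permutations. *)
  rewrite !lvl !peel => ->; congr addn.
  apply: eq_count => p; apply: eq_has => e.
  by rewrite (is_perm_letter_gt0 _ pu) (is_perm_letter_gt0 _ pv).
have move_sum x : \sum_(i < n) mixed_count x (a :: F) E N i + \sum_(i < n) mixed_count x F (a :: E) N i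
   = \sum_(i < n) mixed_count x F [:: a] N i + \sum_(i < n) mixed_count x F E N i.
  by rewrite -!big_split; apply: eq_bigr => i _; apply: mixed_count_move.
have r1 : in_range n (a :: E) N by rewrite /= ra.
have r2 : in_range n [:: a] N by rewrite /= ra.
have := move_sum u; have := move_sum v.
by rewrite (IH _ rF r1) (IH _ rF r2) (IH _ rF rE) => <- /addIn.
Qed.

Definition meet_count (x F : seq nat) (N i : nat) : nat :=
  count (fun p => all (fun e => i < letter x (Posz p - Posz e)%R) F) (iota 0 N).

Lemma sum_meet_count F N : 0 < size F -> in_range n F N ->
  \sum_(i < n) meet_count u F N i = \sum_(i < n) meet_count v F N i.
Proof.
case: F => // a F _ /= /andP[ra rF].
have e x i : meet_count x (a :: F) N i = mixed_count x F [:: a] N i.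
  by apply: eq_count => p /=; rewrite orbF andbC.
by under eq_bigr do rewrite e; under [RHS]eq_bigr do rewrite e; apply: sum_mixed_count => //=; rewrite ra.
Qed.

End SumsOfCounts.

Lemma meet_count_translate_le n u v F N i t : size u = n -> size v = n ->
  0 < size F -> in_range n F N ->
  (forall z, (i < letter v (z + t)%R) = (i < letter u z)) ->
  meet_count u F N i <= meet_count v F N i.
Proof.
move=> su sv hF /allP hr ht.
pose g w (z : int) := all (fun e => i < letter w (z - Posz e)%R) F.
apply: (@count_translate_le (g u) (g v) t) => z.
  by rewrite /g; apply: eq_all => e /=; rewrite -ht; congr (_ < letter _ _); lia.
case: F hF hr @g => // a F _ hr g /= /andP[/letter_gt_range h _].
have := hr a (mem_head _ _); lia.
Qed.

Lemma uniq_level u i : uniq (level u i).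
Proof. by rewrite filter_uniq ?iota_uniq. Qed.

(* An intersection of translates of level [j] along the reflected level [i] records the translates of level [i] of [u] contained in level [j] of [v]. *)
Lemma meet_count_gt0 n u v i j : is_perm n u -> is_perm n v -> i < n -> i <= j ->
  0 < meet_count v [seq n.-1 - k | k <- level u i] (n + n) j ->
  i = j /\ exists t, forall z, (i < letter v (z + t)%R) = (i < letter u z).
Proof.
move=> pu pv hin hij; rewrite -has_count => /hasP[p _]; rewrite all_map => /allP h.
have su := is_perm_size pu; have sv := is_perm_size pv.
(* Since p - (n - 1 - k) = k + (p - (n - 1)), the position [p] encodes this offset. *)
pose t : int := (Posz p - Posz n.-1)%R.
have sub k : k \in level u i -> j < letter v (Posz k + t)%R.
  move=> hk; have := h k hk; rewrite /=.
  have hkn : k < n by move: hk; rewrite mem_filter mem_iota su => /andP[_]; lia.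
  by congr (_ < letter _ _); rewrite /t; lia.
pose s := [seq absz (Posz k + t)%R | k <- level u i].
have posk k : k \in level u i -> Posz (absz (Posz k + t)%R) = (Posz k + t)%R.
  by move=> /sub /letter_gt_range; lia.
have us : uniq s.
  rewrite map_inj_in_uniq ?uniq_level // => k k' /posk hk /posk hk' e; lia.
have ss : {subset s <= level v j}.
  by move=> _ /mapP[k hk ->]; rewrite mem_level posk // sub.
have size_s : size s = n - i by rewrite size_map (size_level _ pu).
(* An injective image of n - i points fits among n - j with i <= j only if i = j, and then it fills
   the level. *)
have := uniq_leq_size us ss; rewrite size_s (size_level _ pv) => le.
have eij : i = j by lia.
split=> //; exists t => z; subst j.
apply/idP/idP => [hz|hz]; last first.
  have [h0 hn] := letter_gt_range hz.
  case: z hz h0 hn => // k hk _ _; apply: sub; rewrite mem_level //.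
have [h0 _] := letter_gt_range hz.
have : absz (z + t)%R \in level v i by rewrite mem_level; case: (z + t)%R h0 hz.
have /(_ (absz (z + t)%R)) <- : s =i level v i.
  by apply: (uniq_min_size us ss _).2; rewrite size_s (size_level _ pv).
move=> /mapP[k hk e]; have -> : z = Posz k by have := posk _ hk; lia.
by rewrite -mem_level.
Qed.

(** Strong induction on the level, with [F] the reflection of P_i(u). Lower levels are translates
    and cancel; higher ones are too small to contain a translate of P_i(u). So the counts at level
    [i] agree, and the one for [u] is positive. *)
Lemma ss_equiv_translate n u v : is_perm n u -> is_perm n v ->
  ss_equiv u v -> translate u v.
Proof.
move=> pu pv hss.
have su := is_perm_size pu; have sv := is_perm_size pv.
have suv : size u = size v by rewrite su sv.
split=> // i; elim/ltn_ind: i => i IH.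
case: (ltnP i n) => hi; last first.
  by exists 0%R => z; rewrite !ltnNge !(leq_trans _ hi) // is_perm_letter_le.
pose F := [seq n.-1 - k | k <- level u i].
have hF : 0 < size F by rewrite size_map (size_level _ pu) subn_gt0.
have rF : in_range n F (n + n) by apply/allP => _ /mapP[k _ ->]; lia.
have n0 : 0 < n by lia.
have c F' N : in_range n F' N -> sumn (cover_word u F' N) = sumn (cover_word v F' N).
  by move=> r; apply: ss_equiv_sumn_cover => //; rewrite su.
have key : forall x, is_perm n x -> \sum_(j < n) meet_count x F (n + n) j
   = \sum_(j < i) meet_count x F (n + n) j + meet_count x F (n + n) i.
  move=> x px; rewrite -(big_mkord xpredT (meet_count x F (n + n))).
  rewrite (big_cat_nat (n := i)) //=; last exact: ltnW.
  rewrite big_mkord; congr addn; rewrite big_ltn // big_nat_cond big1 ?addn0 //.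
  move=> j /andP[/andP[hj _] _]; apply/eqP; rewrite -leqn0 leqNgt; apply/negP.
  by move=> /(meet_count_gt0 pu px hi (ltnW hj))[e]; rewrite e ltnn in hj.
have := sum_meet_count pu pv n0 c hF rF; rewrite !key //.
rewrite (eq_bigr (fun j : 'I_i => meet_count v F (n + n) j)); last first.
  move=> j _; have [t ht] := IH j (ltn_ord j); apply/eqP; rewrite eqn_leq.
  rewrite (meet_count_translate_le su sv hF rF ht).
  apply: (@meet_count_translate_le n v u F (n + n) j (- t)%R) => // z.
  by rewrite -ht subrK.
move=> /addnI e; have : 0 < meet_count v F (n + n) i.
  (* Position n - 1 stands for the offset 0: P_i(u) contains itself. *)
  rewrite -e -has_count; apply/hasP; exists n.-1; first by rewrite mem_iota; lia.
  rewrite all_map; apply/allP => k hk /=.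
  have hkn : k < n by move: hk; rewrite mem_filter mem_iota su => /andP[_]; lia.
  by move: hk; rewrite mem_level; congr (_ < letter _ _); lia.
by move=> /(meet_count_gt0 pu pv hi (leqnn i))[].
Qed.

Lemma ss_equivP n u v : is_perm n u -> is_perm n v ->
  ss_equiv u v <-> translate u v.
Proof.
move=> pu pv; split; [exact: ss_equiv_translate pu pv|exact: translate_ss_equiv].
Qed.

(** * Symmetric levels *)

Lemma is_perm_rev n u : is_perm n u -> is_perm n (rev u).
Proof. by rewrite /is_perm perm_rev. Qed.

Lemma is_perm_next_level n u i : is_perm n u -> i < n ->
  exists x, i < letter u x /\
    forall z, (i.+1 < letter u z) = (i < letter u z) && (z != x).
Proof.
move=> pu hi; have hu : uniq u by rewrite (perm_uniq pu) iota_uniq.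
have hx : i.+1 \in u by rewrite (is_perm_mem _ pu).
exists (Posz (index i.+1 u)) => /=; rewrite nth_index //; split=> // z.
case: z => [k|k] //=; case: (ltnP k (size u)) => hk; last by rewrite nth_default.
have : (nth 0 u k == i.+1) = (Posz k == Posz (index i.+1 u)).
  by rewrite -{1}(nth_index 0 hx) nth_uniq // index_mem.
by move=> <-; lia.
Qed.

Lemma translate_rev_symm u i : translate u (rev u) ->
  exists c : int, forall z, (i < letter u (c - z)%R) = (i < letter u z).
Proof.
move=> [_ ht]; have [t h] := ht i; exists ((size u)%:R - 1 - t)%R => z.
by rewrite -h letter_rev; congr (_ < letter _ _); lia.
Qed.

Definition interval_level (u : seq nat) i :=
  exists a : int, forall z,
    (i < letter u z) = (a <= z)%R && (z < a + Posz (size u - i))%R.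

(** An interval of length 3 without its midpoint. *)
Definition gap_level (u : seq nat) i :=
  exists a : int, forall z, (i < letter u z) = (z == a) || (z == (a + 2)%R).

(* Deleting a point from an interval leaves a symmetric set only if the point is an endpoint or the midpoint. *)
Lemma interval_level_next n u i : is_perm n u -> i < n ->
  translate u (rev u) -> interval_level u i ->
  interval_level u i.+1 \/
  exists a x : int, [/\ (x + x = a + a + Posz (n - i) - 1)%R,
    (a < x)%R, (x < a + Posz (n - i) - 1)%R,
    forall z, (i < letter u z) = (a <= z)%R && (z < a + Posz (n - i))%R &
    forall z, (i.+1 < letter u z) = (i < letter u z) && (z != x)].
Proof.
move=> pu hi sym [a ha]; rewrite (is_perm_size pu) in ha.
have [x [hx hz]] := is_perm_next_level pu hi.
have [c hc] := translate_rev_symm i.+1 sym.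
case: (eqVneq x a) => xa.
  left; exists (a + 1)%R => z; rewrite (is_perm_size pu) hz ha; lia.
case: (eqVneq x (a + Posz (n - i) - 1)%R) => xb.
  left; exists a => z; rewrite (is_perm_size pu) hz ha; lia.
right; exists a, x; rewrite ha in hx.
(* Both ends survive, so [c] is their sum, and the hole [x] must be its own reflection. *)
have h1 := hc a; have h2 := hc (a + Posz (n - i) - 1)%R; have h3 := hc x.
rewrite !hz !ha in h1 h2 h3.
by split=> //; lia.
Qed.

(** Suppose the midpoint [x] of [a, b] is removed, and then [y]. If [y] is an end, the centre moves
    by one half and a neighbour of [x] that is present reflects to the hole [x]. Otherwise the
    centre stays and [y] would have to equal [x]. *)
Lemma interval_level_next_big n u i : is_perm n u -> i + 3 < n ->
  translate u (rev u) -> interval_level u i -> interval_level u i.+1.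
Proof.
move=> pu hi sym /(interval_level_next pu _ sym)[||[a [x [ex ax xb ha hx]]]] //; first lia.
have hi1 : i.+1 < n by lia.
have [y [hy hz]] := is_perm_next_level pu hi1.
have [c hc] := translate_rev_symm i.+2 sym.
pose b := (a + Posz (n - i) - 1)%R.
have {hc}h z : (a <= c - z)%R && (c - z <= b)%R && (c - z != x)%R && (c - z != y)%R
    = (a <= z)%R && (z <= b)%R && (z != x) && (z != y).
  have le_b w : (w < a + Posz (n - i))%R = (w <= b)%R by lia.
  by have := hc z; rewrite !hz !hx !ha !le_b.
have {}hy : (a <= y)%R && (y <= b)%R && (y != x) by rewrite hx ha in hy; lia.
have {}ex : (x + x = a + b)%R by lia.
(* The length is odd and at least 4, hence at least 5, so both neighbours of [x] are interior. *)
have {}xb : (a + 1 < x)%R /\ (x + 1 < b)%R by lia.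
clearbody b; clear -h hy ex xb.
case: (eqVneq y a) => [ya|ya].
  have e : (c = a + b + 1)%R by have := h b; have := h (a + 1)%R; lia.
  have := h (x + 1)%R; lia.
case: (eqVneq y b) => [yb|yb].
  have e : (c = a + b - 1)%R by have := h a; have := h (b - 1)%R; lia.
  have := h (x - 1)%R; lia.
have e : (c = a + b)%R by have := h a; have := h b; lia.
have := h y; lia.
Qed.

Lemma interval_level_top n u i : is_perm n u -> n <= i.+1 -> 0 < n ->
  interval_level u i.
Proof.
move=> pu hi n0; have bd z := is_perm_letter_le z pu.
rewrite /interval_level (is_perm_size pu).
case: (ltnP i n) => hin; last first.
  by exists 0%R => z; have := bd z; lia.
have [x [hx hz]] := is_perm_next_level pu hin.
exists x => z; have := hz z; have := bd z; case: (eqVneq z x) => [->|]; lia.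
Qed.

(** Up to n - 3 the levels stay intervals, and from n - 1 on they have at most one point, so only
    level n - 2 is open. *)
Lemma translate_rev_levels n u : 3 <= n -> is_perm n u -> translate u (rev u) ->
  (forall i, interval_level u i) \/
  gap_level u (n - 2) /\ forall i, i != n - 2 -> interval_level u i.
Proof.
move=> hn pu sym.
have low i : i <= n - 3 -> interval_level u i.
  elim: i => [|i IH] hi.
    by exists 0%R => z; rewrite (is_perm_letter_gt0 _ pu) (is_perm_size pu) subn0 add0r.
  by apply: (interval_level_next_big pu _ sym); [lia|apply: IH; lia].
have top i : n - 1 <= i -> interval_level u i.
  by move=> hi; apply: (interval_level_top pu); lia.
have h3 : n - 3 < n by lia.
have e2 : (n - 3).+1 = n - 2 by lia.
have [h|[a [x [ex ax xb ha hx]]]] := interval_level_next pu h3 sym (low _ (leqnn _)).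
  left=> i; case: (leqP i (n - 3)) => hi; first exact: low.
  case: (eqVneq i (n - 2)) => [->|ne]; first by rewrite -e2.
  by apply: top; lia.
right; split.
  by exists a => z; rewrite -e2 hx ha; lia.
move=> i ne; case: (leqP i (n - 3)) => hi; first exact: low.
by apply: top; lia.
Qed.

Lemma interval_levels_translate u w i : size u = size w ->
  interval_level u i -> interval_level w i ->
  exists t, forall z, (i < letter w (z + t)%R) = (i < letter u z).
Proof.
move=> hs [a ha] [b hb]; exists (b - a)%R => z; rewrite ha hb hs; lia.
Qed.

Lemma gap_levels_translate u w i : gap_level u i -> gap_level w i ->
  exists t, forall z, (i < letter w (z + t)%R) = (i < letter u z).
Proof.
move=> [a ha] [b hb]; exists (b - a)%R => z; rewrite ha hb; lia.
Qed.

Lemma interval_level_rev u i : interval_level u i -> interval_level (rev u) i.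
Proof.
move=> [a ha]; exists ((size u)%:R - a - Posz (size u - i))%R => z.
rewrite letter_rev ha size_rev; lia.
Qed.

Lemma gap_level_rev u i : gap_level u i -> gap_level (rev u) i.
Proof.
move=> [a ha]; exists ((size u)%:R - 3 - a)%R => z.
rewrite letter_rev ha; lia.
Qed.

(** * The two representatives with symmetric levels *)

Lemma id_perm_interval n i : interval_level (id_perm n) i.
Proof.
exists (Posz i) => z; rewrite size_iota; case: z => [k|k] //=.
case: (ltnP k n) => hk; first by rewrite nth_iota //; lia.
by rewrite nth_default ?size_iota //; lia.
Qed.

Lemma size_v_perm n : 3 <= n -> size (v_perm n) = n.
Proof. by move=> hn; rewrite size_cat size_iota /=; lia. Qed.

Lemma nth_v_perm n k : 3 <= n -> nth 0 (v_perm n) k =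
  if k < n - 3 then k.+1 else if k == n - 3 then n - 1
  else if k == n - 2 then n - 2 else if k == n - 1 then n else 0.
Proof.
move=> hn; rewrite nth_cat size_iota; case: ltnP => hk.
  by rewrite nth_iota // add1n.
case: eqVneq => [->|h1]; first by rewrite subnn.
case: eqVneq => [->|h2]; first by have -> : n - 2 - (n - 3) = 1 by lia.
case: eqVneq => [->|h3]; first by have -> : n - 1 - (n - 3) = 2 by lia.
by rewrite nth_default //=; lia.
Qed.

Lemma v_perm_is_perm n : 3 <= n -> is_perm n (v_perm n).
Proof.
case: n => [|[|[|m]]] // _; rewrite /is_perm /v_perm !subSS !subn0.
rewrite -[in iota _ m.+3]addn3 iotaD perm_cat2l add1n /=.
by rewrite (perm_catCA [:: m.+2] [:: m.+1] [:: m.+3]).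
Qed.

Lemma v_perm_gap n : 3 <= n -> gap_level (v_perm n) (n - 2).
Proof.
move=> hn; exists (Posz (n - 3)) => -[k|k]; rewrite [letter _ _]/=; last by lia.
rewrite nth_v_perm //; case: (ltnP k (n - 3)) => h; first by lia.
case: (eqVneq k (n - 3)) => ?; first by lia.
case: (eqVneq k (n - 2)) => ?; first by lia.
case: (eqVneq k (n - 1)) => ?; lia.
Qed.

(** The exchange of n - 2 and n - 1 is visible only at level n - 2; elsewhere the levels are those
    of the identity. *)
Lemma v_perm_interval n i : 3 <= n -> i != n - 2 -> interval_level (v_perm n) i.
Proof.
move=> hn hi; exists (Posz i) => -[k|k]; rewrite [letter _ _]/= size_v_perm //.
rewrite nth_v_perm //; case: (ltnP k (n - 3)) => h; first by lia.
case: (eqVneq k (n - 3)) => ?; first by lia.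
case: (eqVneq k (n - 2)) => ?; first by lia.
case: (eqVneq k (n - 1)) => ?; lia.
Qed.

Lemma translate_id_perm n u : size u = n ->
  (forall i, interval_level u i) -> translate u (id_perm n).
Proof.
move=> su h; have s : size u = size (id_perm n) by rewrite su size_iota.
by split=> // i; apply: interval_levels_translate => //; apply: id_perm_interval.
Qed.

Lemma translate_v_perm n u : 3 <= n -> size u = n -> gap_level u (n - 2) ->
  (forall i, i != n - 2 -> interval_level u i) -> translate u (v_perm n).
Proof.
move=> hn su hg h; have s : size u = size (v_perm n) by rewrite su size_v_perm.
split=> // i; case: (eqVneq i (n - 2)) => [->|ne].
  by apply: gap_levels_translate => //; apply: v_perm_gap.
by apply: interval_levels_translate => //; [apply: h|apply: v_perm_interval].
Qed.

Lemma translate_rev_id_perm n : translate (rev (id_perm n)) (id_perm n).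
Proof.
apply: translate_id_perm; first by rewrite size_rev size_iota.
by move=> i; apply: interval_level_rev; apply: id_perm_interval.
Qed.

Lemma translate_rev_v_perm n : 3 <= n -> translate (rev (v_perm n)) (v_perm n).
Proof.
move=> hn; apply: translate_v_perm => //; first by rewrite size_rev size_v_perm.
  by apply: gap_level_rev; apply: v_perm_gap.
by move=> i hi; apply: interval_level_rev; apply: v_perm_interval.
Qed.

(** For the converse, with c either representative, [u], c, the reversal of c and [rev u] are
    successive translates. *)
Lemma translate_revP n u : 3 <= n -> is_perm n u ->
  translate u (rev u) <-> translate u (id_perm n) \/ translate u (v_perm n).
Proof.
move=> hn pu; have su := is_perm_size pu; split.
  case/(translate_rev_levels hn pu) => [h|[hg h]].
    by left; apply: translate_id_perm.
  by right; apply: translate_v_perm.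
case=> h; apply: (translate_trans h (translate_sym _));
  apply: (translate_trans (translate_rev h)).
  exact: translate_rev_id_perm.
exact: translate_rev_v_perm.
Qed.

Theorem mainTheorem13 (n : nat) (hn : 3 <= n) (u : seq nat) (hu : is_perm n u) :
  ((ss_equiv u (id_perm n) \/ ss_equiv u (v_perm n)) ->
     forall w, is_perm n w -> (shift_equiv u w <-> ss_equiv u w)) /\
  (~ (ss_equiv u (id_perm n) \/ ss_equiv u (v_perm n)) ->
     (forall w, is_perm n w -> (shift_equiv u w <-> ss_equiv u w \/ ss_equiv (rev u) w)) /\
     (forall w, is_perm n w -> ~ (ss_equiv u w /\ ss_equiv (rev u) w))).
Proof.
have pr := is_perm_rev hu.
have pid : is_perm n (id_perm n) by apply: perm_refl.
have pv := v_perm_is_perm hn.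
(* The case distinction becomes whether [u] is a translate of its reversal. *)
rewrite (ss_equivP hu pid) (ss_equivP hu pv) -(translate_revP hn hu).
split=> [sym w pw|nsym].
  rewrite shift_equivP (ss_equivP hu pw); split=> [[//|]|]; last by left.
  exact: translate_trans.
split=> w pw; first by rewrite shift_equivP (ss_equivP hu pw) (ss_equivP pr pw).
rewrite (ss_equivP hu pw) (ss_equivP pr pw) => -[h1 h2].
by apply: nsym; exact: translate_trans h1 (translate_sym h2).
Qed.
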